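(* Under the discrete periodic boundary conditions, the numerical solution $(U^{(n)},M^{(n)})_{n\ge 0}$, with $U^{(n)}=(U^{(n)}_1,U^{(n)}_2)$ and $M^{(n)}=(M^{(n)}_1,M^{(n)}_2)$, produced by Scheme 2 (as defined in the context) conserves the following invariants: for each $n=1,2,\ldots$ and each component $i\in\{1,2\}$, $$\sum_{j=0}^{\mathcal J-1}\sum_{k=0}^{\mathcal K-1} U^{(n)}_{i;k,j}\,\Delta x\,\Delta y=\sum_{j=0}^{\mathcal J-1}\sum_{k=0}^{\mathcal K-1} U^{(0)}_{i;k,j}\,\Delta x\,\Delta y ,$$ and $$\sum_{j=0}^{\mathcal J-1}\sum_{k=0}^{\mathcal K-1} H^{(n+\frac12)}_{k,j}\,\Delta x\,\Delta y=\sum_{j=0}^{\mathcal J-1}\sum_{k=0}^{\mathcal K-1} H^{(\frac12)}_{k,j}\,\Delta x\,\Delta y ,$$ where, for $n\ge 0$, $$H^{(n+\frac12)}_{k,j}=\tfrac14\Big(M^{(n+1)}_{1;k,j}U^{(n)}_{1;k,j}+M^{(n)}_{1;k,j}U^{(n+1)}_{1;k,j}+M^{(n+1)}_{2;k,j}U^{(n)}_{2;k,j}+M^{(n)}_{2;k,j}U^{(n+1)}_{2;k,j}\Big).$$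
   Context: Fix $\alpha>0$, a time step $\Delta t>0$, and integers $\mathcal K,\mathcal J\ge 1$; put $\Delta x=2/\mathcal K$, $\Delta y=2/\mathcal J$. Grid functions are real arrays $f=(f_{k,j})$, $0\le k\le\mathcal K-1$, $0\le j\le\mathcal J-1$, where $k$ is the index in the $x$ direction and $j$ the index in the $y$ direction; they are extended periodically ($k$ modulo $\mathcal K$, $j$ modulo $\mathcal J$; these are the discrete periodic boundary conditions). Products of grid functions are entrywise. The discrete operators are $$\delta_k^{<1>}f_{k,j}=\frac{f_{k+1,j}-f_{k-1,j}}{2\Delta x},\quad \delta_j^{<1>}f_{k,j}=\frac{f_{k,j+1}-f_{k,j-1}}{2\Delta y},$$ $$\delta_{kk}^{<2>}f_{k,j}=\frac{f_{k+1,j}-2f_{k,j}+f_{k-1,j}}{\Delta x^2},\quad \delta_{jj}^{<2>}f_{k,j}=\frac{f_{k,j+1}-2f_{k,j}+f_{k,j-1}}{\Delta y^2}.$$ At each time level $n$ the discrete velocity $U^{(n)}_i$ and momentum $M^{(n)}_i$ ($i=1,2$) are grid functions related by $M^{(n)}_{i;k,j}=(1-\alpha^2\delta_{kk}^{<2>}-\alpha^2\delta_{jj}^{<2>})U^{(n)}_{i;k,j}$. Scheme 2 is the explicit multi-step scheme which determines level $n+1$ from levels $n$ and $n-1$, for $n\ge1$ and all $k,j$, by $$\frac{M^{(n+1)}_{1;k,j}-M^{(n-1)}_{1;k,j}}{2\Delta t}=-\Big[M^{(n)}_{1;k,j}\,\delta_k^{<1>}U^{(n)}_{1;k,j}+M^{(n)}_{2;k,j}\,\delta_k^{<1>}U^{(n)}_{2;k,j}+\delta_k^{<1>}\big(M^{(n)}_{1;k,j}U^{(n)}_{1;k,j}\big)+\delta_j^{<1>}\big(M^{(n)}_{1;k,j}U^{(n)}_{2;k,j}\big)\Big],$$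 $$\frac{M^{(n+1)}_{2;k,j}-M^{(n-1)}_{2;k,j}}{2\Delta t}=-\Big[M^{(n)}_{1;k,j}\,\delta_j^{<1>}U^{(n)}_{1;k,j}+M^{(n)}_{2;k,j}\,\delta_j^{<1>}U^{(n)}_{2;k,j}+\delta_k^{<1>}\big(M^{(n)}_{2;k,j}U^{(n)}_{1;k,j}\big)+\delta_j^{<1>}\big(M^{(n)}_{2;k,j}U^{(n)}_{2;k,j}\big)\Big].$$
   Formalization: The conservation of the sum of U_i is proved assuming that U_i^(1) and U_i^(0) have the same sum; Scheme 2 leaves level 1 free, and without this the claim fails at n = 1 (e.g. on a one-point grid with U^(0)=0, U^(1)=1). *)

(* Defs.v *)
(* Mathematical Components, with the abstract real numbers [realType]. *)
From HB Require Import structures.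
From mathcomp Require Import all_boot all_order all_algebra.
From mathcomp Require Import reals.

Set Implicit Arguments.
Unset Strict Implicit.
Unset Printing Implicit Defensive.

Import Order.TTheory GRing.Theory Num.Theory.
Local Open Scope ring_scope.

Section Grid.
Variables (R : realType) (K J : nat).

Definition grid := 'I_K -> 'I_J -> R.

Definition dx : R := 2 / K%:R.
Definition dy : R := 2 / J%:R.

Definition gmul (f g : grid) : grid := fun k j => f k j * g k j.

(* [ordS] and [ord_pred] are the successor and predecessor modulo the size of
   the index set, so they implement the periodic extension. *)
Definition delta_k1 (f : grid) : grid := fun k j =>
  (f (ordS k) j - f (ord_pred k) j) / (2 * dx).

Definition delta_j1 (f : grid) : grid := fun k j =>
  (f k (ordS j) - f k (ord_pred j)) / (2 * dy).

Definition delta_kk2 (f : grid) : grid := fun k j =>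
  (f (ordS k) j - 2 * f k j + f (ord_pred k) j) / dx ^+ 2.

Definition delta_jj2 (f : grid) : grid := fun k j =>
  (f k (ordS j) - 2 * f k j + f k (ord_pred j)) / dy ^+ 2.

Definition gsum (f : grid) : R :=
  \sum_(j < J) \sum_(k < K) f k j * dx * dy.

(* [w n i] is the grid function of component i + 1 at time level n. *)
Definition grid_seq := nat -> 'I_2 -> grid.

End Grid.

Notation cmp1 := (ord0 : 'I_2).
Notation cmp2 := (ord_max : 'I_2).

Section Scheme.
Variables (R : realType) (K J : nat).
Implicit Types U M : grid_seq R K J.

Definition momentum_of (alpha : R) U M : Prop :=
  forall (n : nat) (i : 'I_2) (k : 'I_K) (j : 'I_J),
    M n i k j = U n i k j - alpha ^+ 2 * delta_kk2 (U n i) k j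
                          - alpha ^+ 2 * delta_jj2 (U n i) k j.

(* No condition is put on level 1: a two-step scheme takes it as starting
   data, together with level 0. *)
Definition scheme2 (dt : R) U M : Prop :=
  forall (n : nat) (k : 'I_K) (j : 'I_J), (1 <= n)%N ->
    (M n.+1 cmp1 k j - M n.-1 cmp1 k j) / (2 * dt) =
      - (M n cmp1 k j * delta_k1 (U n cmp1) k j
         + M n cmp2 k j * delta_k1 (U n cmp2) k j
         + delta_k1 (gmul (M n cmp1) (U n cmp1)) k j
         + delta_j1 (gmul (M n cmp1) (U n cmp2)) k j)
    /\
    (M n.+1 cmp2 k j - M n.-1 cmp2 k j) / (2 * dt) =
      - (M n cmp1 k j * delta_j1 (U n cmp1) k j
         + M n cmp2 k j * delta_j1 (U n cmp2) k j
         + delta_k1 (gmul (M n cmp2) (U n cmp1)) k j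
         + delta_j1 (gmul (M n cmp2) (U n cmp2)) k j).

(* The discrete energy density at time level n + 1/2. *)
Definition Hhalf U M (n : nat) : grid R K J := fun k j =>
  4^-1 * (M n.+1 cmp1 k j * U n cmp1 k j + M n cmp1 k j * U n.+1 cmp1 k j
          + M n.+1 cmp2 k j * U n cmp2 k j + M n cmp2 k j * U n.+1 cmp2 k j).

End Scheme.

(* Main.v *)
(* Both invariants come from summation by parts on the periodic grid: the
   centred differences are skew-adjoint, the second differences are
   self-adjoint, and all of them commute.  Let L be the (self-adjoint) operator
   that sends U to M.  As L commutes with the skew-adjoint centred difference
   D, the sum of (L U) (D U) is its own opposite, so the right-hand sides of the
   scheme sum to zero; and L preserves sums.  For the energy, self-adjointness
   of L reduces the increment to the sum over i of (M_i^(n+1) - M_i^(n-1)) U_i^(n),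
   in which the eight terms of the scheme cancel in pairs by skew-adjointness. *)
Require Import Defs.
From HB Require Import structures.
From mathcomp Require Import all_boot all_order all_algebra.
From mathcomp Require Import reals ring.

Set Implicit Arguments.
Unset Strict Implicit.
Unset Printing Implicit Defensive.

Import Order.TTheory GRing.Theory Num.Theory.
Local Open Scope ring_scope.

(** * Summation by parts on the periodic grid *)

Section DiscreteCalculus.
Variables (R : realType) (K J : nat).
Implicit Types (f g h : grid R K J) (a : R).

Definition helmholtz a f : grid R K J := fun k j =>
  f k j - a ^+ 2 * delta_kk2 f k j - a ^+ 2 * delta_jj2 f k j.

Lemma eq_gsum f g : (forall k j, f k j = g k j) -> gsum f = gsum g.
Proof. by move=> fg; apply: eq_bigr => j _; apply: eq_bigr => k _; rewrite fg. Qed.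

Lemma gsumD f g : gsum (fun k j => f k j + g k j) = gsum f + gsum g.
Proof.
rewrite /gsum -big_split; apply: eq_bigr => j _.
by rewrite -big_split; apply: eq_bigr => k _; rewrite /= !mulrDl.
Qed.

Lemma gsumZ a f : gsum (fun k j => a * f k j) = a * gsum f.
Proof.
rewrite /gsum mulr_sumr; apply: eq_bigr => j _.
by rewrite mulr_sumr; apply: eq_bigr => k _; rewrite !mulrA.
Qed.

Lemma gsumN f : gsum (fun k j => - f k j) = - gsum f.
Proof. by rewrite -mulN1r -gsumZ; apply: eq_gsum => k j; rewrite mulN1r. Qed.

Lemma gsumB f g : gsum (fun k j => f k j - g k j) = gsum f - gsum g.
Proof. by rewrite gsumD gsumN. Qed.

Lemma gsum_shift_k f : gsum (fun k j => f (ord_pred k) j) = gsum f.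
Proof.
apply: eq_bigr => j _; rewrite [RHS](reindex_inj (can_inj (@ord_predK K))).
by [].
Qed.

Lemma gsum_shift_j f : gsum (fun k j => f k (ord_pred j)) = gsum f.
Proof. by rewrite [RHS](reindex_inj (can_inj (@ord_predK J))). Qed.

(** Since a periodic shift permutes the grid, a backward difference sums to zero. Each
    summation-by-parts identity below then only needs a flux [h], and [ring] checks the rest
    pointwise. *)
Lemma gsum_telescope_k h f :
  (forall k j, f k j = h k j - h (ord_pred k) j) -> gsum f = 0.
Proof. by move=> /eq_gsum->; rewrite gsumB gsum_shift_k subrr. Qed.

Lemma gsum_telescope_j h f :
  (forall k j, f k j = h k j - h k (ord_pred j)) -> gsum f = 0.
Proof. by move=> /eq_gsum->; rewrite gsumB gsum_shift_j subrr. Qed.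

Lemma gsum_delta_k1 f : gsum (delta_k1 f) = 0.
Proof.
apply: (@gsum_telescope_k (fun k j => (f (ordS k) j + f k j) / (2 * dx R K))).
by move=> k j; rewrite /delta_k1 ord_predK; ring.
Qed.

Lemma gsum_delta_j1 f : gsum (delta_j1 f) = 0.
Proof.
apply: (@gsum_telescope_j (fun k j => (f k (ordS j) + f k j) / (2 * dy R J))).
by move=> k j; rewrite /delta_j1 ord_predK; ring.
Qed.

Lemma gsum_helmholtz a f : gsum (helmholtz a f) = gsum f.
Proof.
rewrite !gsumB !gsumZ.
have -> : gsum (delta_kk2 f) = 0.
  (* A second difference is the backward difference of the forward difference. *)
  apply: (@gsum_telescope_k (fun k j => (f (ordS k) j - f k j) / dx R K ^+ 2)).
  by move=> k j; rewrite /delta_kk2 ord_predK; ring.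
have -> : gsum (delta_jj2 f) = 0.
  apply: (@gsum_telescope_j (fun k j => (f k (ordS j) - f k j) / dy R J ^+ 2)).
  by move=> k j; rewrite /delta_jj2 ord_predK; ring.
by rewrite !mulr0 !subr0.
Qed.

(** Discrete product rule: the flux is the symmetrised product of [f] and [g] at neighbouring
    points, and the diagonal terms never appear. *)
Lemma delta_k1_skew f g :
  gsum (gmul f (delta_k1 g)) = - gsum (gmul (delta_k1 f) g).
Proof.
apply/eqP; rewrite -addr_eq0 -gsumD; apply/eqP.
apply: (@gsum_telescope_k (fun k j =>
  (f k j * g (ordS k) j + f (ordS k) j * g k j) / (2 * dx R K))).
by move=> k j; rewrite /gmul /delta_k1 ord_predK; ring.
Qed.

Lemma delta_j1_skew f g :
  gsum (gmul f (delta_j1 g)) = - gsum (gmul (delta_j1 f) g).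
Proof.
apply/eqP; rewrite -addr_eq0 -gsumD; apply/eqP.
apply: (@gsum_telescope_j (fun k j =>
  (f k j * g k (ordS j) + f k (ordS j) * g k j) / (2 * dy R J))).
by move=> k j; rewrite /gmul /delta_j1 ord_predK; ring.
Qed.

(** Discrete Green identity, whose flux is a discrete Wronskian of [f] and [g]. *)
Lemma delta_kk2_sym f g :
  gsum (gmul f (delta_kk2 g)) = gsum (gmul (delta_kk2 f) g).
Proof.
apply/eqP; rewrite -subr_eq0 -gsumB; apply/eqP.
apply: (@gsum_telescope_k (fun k j =>
  (f k j * g (ordS k) j - f (ordS k) j * g k j) / dx R K ^+ 2)).
by move=> k j; rewrite /gmul /delta_kk2 ord_predK; ring.
Qed.

Lemma delta_jj2_sym f g :
  gsum (gmul f (delta_jj2 g)) = gsum (gmul (delta_jj2 f) g).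
Proof.
apply/eqP; rewrite -subr_eq0 -gsumB; apply/eqP.
apply: (@gsum_telescope_j (fun k j =>
  (f k j * g k (ordS j) - f k (ordS j) * g k j) / dy R J ^+ 2)).
by move=> k j; rewrite /gmul /delta_jj2 ord_predK; ring.
Qed.

Lemma helmholtz_sym a f g :
  gsum (gmul f (helmholtz a g)) = gsum (gmul (helmholtz a f) g).
Proof.
transitivity (gsum (gmul f g) - a ^+ 2 * gsum (gmul f (delta_kk2 g))
                              - a ^+ 2 * gsum (gmul f (delta_jj2 g))).
  by rewrite -!gsumZ -!gsumB; apply: eq_gsum => k j; rewrite /gmul /helmholtz; ring.
rewrite delta_kk2_sym delta_jj2_sym -!gsumZ -!gsumB.
by apply: eq_gsum => k j; rewrite /gmul /helmholtz; ring.
Qed.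

Lemma helmholtz_delta_k1 a f k j :
  helmholtz a (delta_k1 f) k j = delta_k1 (helmholtz a f) k j.
Proof.
by rewrite /helmholtz /delta_k1 /delta_kk2 /delta_jj2 !ordSK !ord_predK; ring.
Qed.

Lemma helmholtz_delta_j1 a f k j :
  helmholtz a (delta_j1 f) k j = delta_j1 (helmholtz a f) k j.
Proof.
by rewrite /helmholtz /delta_j1 /delta_kk2 /delta_jj2 !ordSK !ord_predK; ring.
Qed.

Lemma gmulC f g k j : gmul f g k j = gmul g f k j.
Proof. exact: mulrC. Qed.

Lemma gsum_helmholtz_delta_k1 a f :
  gsum (gmul (helmholtz a f) (delta_k1 f)) = 0.
Proof.
set s := LHS; suff: s = - s by move/eqP; rewrite -addr_eq0 -mulr2n mulrn_eq0 => /eqP.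
rewrite {1}/s -helmholtz_sym (eq_gsum (g := gmul f (delta_k1 (helmholtz a f)))).
  by rewrite delta_k1_skew (eq_gsum (gmulC _ _)).
by move=> k j; rewrite /gmul helmholtz_delta_k1.
Qed.

Lemma gsum_helmholtz_delta_j1 a f :
  gsum (gmul (helmholtz a f) (delta_j1 f)) = 0.
Proof.
set s := LHS; suff: s = - s by move/eqP; rewrite -addr_eq0 -mulr2n mulrn_eq0 => /eqP.
rewrite {1}/s -helmholtz_sym (eq_gsum (g := gmul f (delta_j1 (helmholtz a f)))).
  by rewrite delta_j1_skew (eq_gsum (gmulC _ _)).
by move=> k j; rewrite /gmul helmholtz_delta_j1.
Qed.

End DiscreteCalculus.

(** * Conservation along solutions of the scheme *)

Section Conservation.
Variables (R : realType) (K J : nat) (alpha dt : R) (U M : grid_seq R K J).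
Hypothesis dt_gt0 : 0 < dt.
Hypotheses (hM : momentum_of alpha U M) (hscheme : scheme2 dt U M).

Lemma gsum_momentum n i : gsum (M n i) = gsum (U n i).
Proof. by rewrite (eq_gsum (hM n i)) gsum_helmholtz. Qed.

(** The operator from U to M is the same at every level, so its self-adjointness also exchanges U
    and M across two different time levels. *)
Lemma gsum_momentum_sym m n i :
  gsum (gmul (M m i) (U n i)) = gsum (gmul (U m i) (M n i)).
Proof.
rewrite (@eq_gsum _ _ _ _ (gmul (helmholtz alpha (U m i)) (U n i))); last first.
  by move=> k j; rewrite /gmul hM.
rewrite -helmholtz_sym; apply: eq_gsum => k j.
by rewrite /gmul hM.
Qed.

Lemma gsum_momentum_delta_k1 n i :
  gsum (gmul (M n i) (delta_k1 (U n i))) = 0.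
Proof.
rewrite -[RHS](gsum_helmholtz_delta_k1 alpha (U n i)).
by apply: eq_gsum => k j; rewrite /gmul hM.
Qed.

Lemma gsum_momentum_delta_j1 n i :
  gsum (gmul (M n i) (delta_j1 (U n i))) = 0.
Proof.
rewrite -[RHS](gsum_helmholtz_delta_j1 alpha (U n i)).
by apply: eq_gsum => k j; rewrite /gmul hM.
Qed.

(** The scheme at level [n.+1], solved for the newest momentum; the shift of index removes the
    predecessor [n.-1]. *)
Lemma momentum_step1 n k j :
  M n.+2 cmp1 k j = M n cmp1 k j - 2 * dt *
    (gmul (M n.+1 cmp1) (delta_k1 (U n.+1 cmp1)) k j
     + gmul (M n.+1 cmp2) (delta_k1 (U n.+1 cmp2)) k j
     + delta_k1 (gmul (M n.+1 cmp1) (U n.+1 cmp1)) k j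
     + delta_j1 (gmul (M n.+1 cmp1) (U n.+1 cmp2)) k j).
Proof.
have [+ _] := hscheme k j (ltn0Sn n); rewrite /= => /(canRL (mulfVK _)) E.
rewrite -[LHS](subrK (M n cmp1 k j)) E /gmul; first by ring.
by rewrite mulf_neq0 ?pnatr_eq0 ?gt_eqF.
Qed.

Lemma momentum_step2 n k j :
  M n.+2 cmp2 k j = M n cmp2 k j - 2 * dt *
    (gmul (M n.+1 cmp1) (delta_j1 (U n.+1 cmp1)) k j
     + gmul (M n.+1 cmp2) (delta_j1 (U n.+1 cmp2)) k j
     + delta_k1 (gmul (M n.+1 cmp2) (U n.+1 cmp1)) k j
     + delta_j1 (gmul (M n.+1 cmp2) (U n.+1 cmp2)) k j).
Proof.
have [_ +] := hscheme k j (ltn0Sn n); rewrite /= => /(canRL (mulfVK _)) E.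
rewrite -[LHS](subrK (M n cmp2 k j)) E /gmul; first by ring.
by rewrite mulf_neq0 ?pnatr_eq0 ?gt_eqF.
Qed.

Lemma gsum_velocity_step n i : gsum (U n.+2 i) = gsum (U n i).
Proof.
rewrite -!gsum_momentum; have [->|->] : i = cmp1 \/ i = cmp2.
- by case: i => -[|[]] // ltm; [left|right]; apply: val_inj.
- rewrite (eq_gsum (momentum_step1 n)) gsumB gsumZ !gsumD.
  rewrite !gsum_momentum_delta_k1 gsum_delta_k1 gsum_delta_j1.
  by rewrite !addr0 mulr0 subr0.
- rewrite (eq_gsum (momentum_step2 n)) gsumB gsumZ !gsumD.
  rewrite !gsum_momentum_delta_j1 gsum_delta_k1 gsum_delta_j1.
  by rewrite !addr0 mulr0 subr0.
Qed.

Lemma gsum_HhalfE n :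
  gsum (Hhalf U M n) = 2^-1 * (gsum (gmul (U n cmp1) (M n.+1 cmp1))
                               + gsum (gmul (U n cmp2) (M n.+1 cmp2))).
Proof.
transitivity (4^-1 * (gsum (gmul (U n cmp1) (M n.+1 cmp1))
    + gsum (gmul (M n cmp1) (U n.+1 cmp1))
    + gsum (gmul (U n cmp2) (M n.+1 cmp2))
    + gsum (gmul (M n cmp2) (U n.+1 cmp2)))).
  rewrite -!gsumD -gsumZ; apply: eq_gsum => k j.
  by rewrite /Hhalf /gmul; ring.
by rewrite !gsum_momentum_sym; field.
Qed.

Lemma gsum_Hhalf_step n : gsum (Hhalf U M n.+1) = gsum (Hhalf U M n).
Proof.
(* Only the energy at level [n] is flipped, so that both energies carry the common factor [U n.+1]
   and their difference involves [M n.+2 - M n]. *)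
rewrite !gsum_HhalfE -!(gsum_momentum_sym n).
rewrite !(eq_gsum (gmulC (M n _) _)).
set V := U n.+1; set N := M n.+1.
congr (_ * _); apply/eqP; rewrite -subr_eq0 -!gsumD -gsumB; apply/eqP.
(* With D_1, D_2 the centred differences in x and y, the term N_a V_b D_b V_a from equation b is
   paired with D_b(N_a V_b) V_a from equation a. *)
transitivity (- (2 * dt) * (
    (gsum (gmul (gmul (N cmp1) (V cmp1)) (delta_k1 (V cmp1)))
     + gsum (gmul (delta_k1 (gmul (N cmp1) (V cmp1))) (V cmp1)))
  + (gsum (gmul (gmul (N cmp2) (V cmp1)) (delta_k1 (V cmp2)))
     + gsum (gmul (delta_k1 (gmul (N cmp2) (V cmp1))) (V cmp2)))
  + (gsum (gmul (gmul (N cmp1) (V cmp2)) (delta_j1 (V cmp1)))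
     + gsum (gmul (delta_j1 (gmul (N cmp1) (V cmp2))) (V cmp1)))
  + (gsum (gmul (gmul (N cmp2) (V cmp2)) (delta_j1 (V cmp2)))
     + gsum (gmul (delta_j1 (gmul (N cmp2) (V cmp2))) (V cmp2))))).
  rewrite -!gsumD -gsumZ; apply: eq_gsum => k j.
  rewrite /gmul momentum_step1 momentum_step2 -/V -/N /gmul; ring.
by rewrite !delta_k1_skew !delta_j1_skew !addNr !addr0 mulr0.
Qed.

End Conservation.

(* A two-step scheme propagates the sum of U separately along even and odd
   levels, so level 1 must carry the same sum as level 0: this is the premise
   of the first conclusion (it is its instance n = 1).  The second conclusion
   holds for arbitrary starting data. *)
Theorem theorem4 (R : realType) (K J : nat) (alpha dt : R)
    (U M : grid_seq R K J)
    (hK : (1 <= K)%N) (hJ : (1 <= J)%N) (halpha : 0 < alpha) (hdt : 0 < dt)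
    (hM : momentum_of alpha U M) (hscheme : scheme2 dt U M) :
  (forall i : 'I_2, gsum (U 1%N i) = gsum (U 0%N i) ->
     forall n : nat, (1 <= n)%N -> gsum (U n i) = gsum (U 0%N i))
  /\
  (forall n : nat, (1 <= n)%N -> gsum (Hhalf U M n) = gsum (Hhalf U M 0%N)).
Proof.
split=> [i U10 n _|n _].
  (* The recurrence skips one level, so the induction carries two consecutive ones. *)
  suff [] : gsum (U n i) = gsum (U 0 i) /\ gsum (U n.+1 i) = gsum (U 0 i) by [].
  elim: n => [//|n [IHn IHn1]]; split=> //.
  by rewrite (gsum_velocity_step hdt hM hscheme).
by elim: n => // n <-; apply: gsum_Hhalf_step hdt hM hscheme n.
Qed.
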